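(* Let $(D,V)$ be an admissible pair and $\mathcal{J}$ a closed $D$-invariant subspace of $C^\infty(D)$. Then $\sigma(D|_{\mathcal{J}})$ is either all of $\mathbb{C}$, or it equals the discrete (possibly empty) set $\{\lambda\in\mathbb{C}:\phi_\lambda\in\mathcal{J}\}$. If $\sigma(D|_{\mathcal{J}})\ne\mathbb{C},\emptyset$, then for each $\lambda\in\sigma(D|_{\mathcal{J}})$ the kernel of $(D-\lambda I)|_{\mathcal{J}}$ is one-dimensional (spanned by $\phi_\lambda$).
   Context: Let $H$ be a separable complex Hilbert space. A pair $(D,V)$ of operators is called admissible if: (i) $D:\mathscr{D}(D)\subset H\to H$ is a densely defined closed linear operator; (ii) $\dim\ker D=1$; (iii) $D$ has a self-adjoint restriction with compact resolvent; (iv) $V:H\to H$ is a compact operator with $\sigma(V)=\{0\}$; (v) $\operatorname{Ran}V\subset\mathscr{D}(D)$ and $DV=I$. Fix $0\neq\phi_0\in\ker D$ and put $\phi_\lambda=(I-\lambda V)^{-1}\phi_0$ for $\lambda\in\mathbb{C}$. Let $\mathscr{D}(D^1)=\mathscr{D}(D)$, $\mathscr{D}(D^n)=\{x\in\mathscr{D}(D^{n-1}):D^{n-1}x\in\mathscr{D}(D)\}$, and $C^\infty(D)=\bigcap_{n\ge1}\mathscr{D}(D^n)$, a Fréchet space with the metric $d(x,y)=\sum_{j\ge0}2^{-j}\frac{\|D^jx-D^jy\|_H}{1+\|D^jx-D^jy\|_H}$; $D$ acts continuously on $C^\infty(D)$. For a closed subspace $\mathcal{J}\subset C^\infty(D)$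 with $D\mathcal{J}\subset\mathcal{J}$, $\sigma(D|_{\mathcal{J}})$ is the set of $\lambda\in\mathbb{C}$ for which $(D-\lambda I)|_{\mathcal{J}}:\mathcal{J}\to\mathcal{J}$ is not bijective. *)

(* Defs.v *)
From mathcomp Require Import all_boot all_order all_algebra.
From mathcomp Require Import all_classical all_reals all_analysis.
From mathcomp Require Import complex.
Import Order.TTheory GRing.Theory Num.Theory.
Import numFieldNormedType.Exports.
Local Open Scope classical_set_scope.
Local Open Scope ring_scope.

Set Implicit Arguments.
Unset Strict Implicit.
Unset Printing Implicit Defensive.

(* Throughout, R : realType and the scalar field is C := R[i].
   A (complex) Hilbert space is a complete normed C-space H together with an
   inner product ip (linear in the first argument, conjugate symmetric)
   inducing the norm. *)

Definition is_inner_product (R : realType) (H : completeNormedModType R[i])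
  (ip : H -> H -> R[i]) : Prop :=
  [/\ forall (a : R[i]) (x y z : H), ip (a *: x + y) z = a * ip x z + ip y z,
      forall x y : H, ip y x = (ip x y)^*
    & forall x : H, ip x x = `|x| ^+ 2].

Definition separable (T : topologicalType) : Prop :=
  exists u : nat -> T, dense (range u).

(* A linear operator with domain [dom] is represented by a total function
   [D : H -> H] of which only the values on [dom] matter. *)
Definition is_subspace (R : realType) (H : completeNormedModType R[i])
  (S : set H) : Prop :=
  S 0 /\ forall (a : R[i]) (x y : H), S x -> S y -> S (a *: x + y).

Definition linear_on (R : realType) (H : completeNormedModType R[i])
  (dom : set H) (D : H -> H) : Prop :=
  forall (a : R[i]) (x y : H), dom x -> dom y -> D (a *: x + y) = a *: D x + D y.

Definition lin_op (R : realType) (H : completeNormedModType R[i])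
  (dom : set H) (D : H -> H) : Prop := is_subspace dom /\ linear_on dom D.

Definition closed_op (R : realType) (H : completeNormedModType R[i])
  (dom : set H) (D : H -> H) : Prop :=
  closed [set p : H * H | dom p.1 /\ p.2 = D p.1].

(* (unbounded) self-adjoint operator A = A^*, where
   dom A^* = {y | exists z, forall x in dom A, <A x, y> = <x, z>}. *)
Definition self_adjoint (R : realType) (H : completeNormedModType R[i])
  (ip : H -> H -> R[i]) (dom : set H) (A : H -> H) : Prop :=
  [/\ lin_op dom A, dense dom,
      (forall y : H, dom y <-> exists z : H, forall x, dom x -> ip (A x) y = ip x z)
    & forall x y : H, dom x -> dom y -> ip (A x) y = ip x (A y)].

Definition compact_op (R : realType) (H : completeNormedModType R[i])
  (T : H -> H) : Prop :=
  (forall (a : R[i]) (x y : H), T (a *: x + y) = a *: T x + T y) /\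
  compact (closure (T @` ball (0 : H) 1)).

Definition compact_resolvent (R : realType) (H : completeNormedModType R[i])
  (dom : set H) (A : H -> H) : Prop :=
  exists (z : R[i]) (Rz : H -> H),
    [/\ forall y, dom (Rz y) /\ A (Rz y) - z *: Rz y = y,
        forall x, dom x -> Rz (A x - z *: x) = x
      & compact_op Rz].

Definition spectrum_op (R : realType) (H : completeNormedModType R[i])
  (V : H -> H) : set R[i] :=
  [set lam | ~ bijective (fun x => V x - lam *: x)].

Definition admissible (R : realType) (H : completeNormedModType R[i])
  (ip : H -> H -> R[i]) (dom : set H) (D V : H -> H) : Prop :=
  [/\ lin_op dom D /\ dense dom /\ closed_op dom D,
      (exists phi0 : H, [/\ phi0 != 0, dom phi0, D phi0 = 0 &
          forall x, dom x -> D x = 0 -> exists c : R[i], x = c *: phi0]),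
      (exists domA : set H, [/\ domA `<=` dom, self_adjoint ip domA D
                               & compact_resolvent domA D]),
      compact_op V /\ spectrum_op V = [set 0]
    & forall x : H, dom (V x) /\ D (V x) = x].

Definition phi (R : realType) (H : completeNormedModType R[i])
  (V : H -> H) (phi0 : H) (lam : R[i]) : H :=
  xget 0 [set x | x - lam *: V x = phi0].

Definition Cinf (R : realType) (H : completeNormedModType R[i])
  (dom : set H) (D : H -> H) : set H :=
  [set x | forall n : nat, dom (iter n D x)].

Definition dinf (R : realType) (H : completeNormedModType R[i])
  (D : H -> H) (x y : H) : R :=
  limn (series (fun j : nat =>
    let t := complex.Re `|iter j D x - iter j D y| in
    (2 ^- j) * (t / (1 + t)))).

Definition closed_in_Cinf (R : realType) (H : completeNormedModType R[i])
  (dom : set H) (D : H -> H) (J : set H) : Prop :=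
  forall x, Cinf dom D x ->
    (forall e : R, 0 < e -> exists y, J y /\ dinf D x y < e) -> J x.

Definition spec_on (R : realType) (H : completeNormedModType R[i])
  (D : H -> H) (J : set H) : set R[i] :=
  [set lam | ~ ((forall x y, J x -> J y ->
                   D x - lam *: x = D y - lam *: y -> x = y) /\
                (forall y, J y -> exists x, J x /\ D x - lam *: x = y))].

Definition discrete_set (R : realType) (S : set R[i]) : Prop :=
  forall lam, S lam -> exists e : R[i], 0 < e /\
    forall mu, S mu -> `|mu - lam| < e -> mu = lam.

(* Main.v *)
Require Import Defs.
From mathcomp Require Import all_boot all_order all_algebra.
From mathcomp Require Import all_classical all_reals all_analysis.
From mathcomp Require Import complex.
From mathcomp Require Import lra zify.
Import Order.TTheory GRing.Theory Num.Theory.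
Import numFieldNormedType.Exports.
Local Open Scope classical_set_scope.
Local Open Scope ring_scope.

Set Implicit Arguments.
Unset Strict Implicit.
Unset Printing Implicit Defensive.

(* Suppose D - l0 is bijective on J, with inverse Q. Compactness of V gives a
   Rellich property: sequences bounded in the graph norm of D converge along a
   free ultrafilter.
   - Q is bounded from some graph norm N_n to the norm of H: otherwise there are
     unit vectors y_k in J with (D - l0) y_k -> 0 in C^oo(D); they converge in
     C^oo(D) to a unit vector of J in the kernel of D - l0, a contradiction.
     Hence Q gains one derivative, N_(m+1) (Q x) <= C N_m x for m >= n, and is
     compact on (J, N_n).
   - (J, N_n) is not complete, but an N_n-limit of approximate solutions of
     x - mu Q x = y can be bootstrapped through Q into J, so the Riesz theory of
     compact operators applies on J: I - mu Q is surjective when it is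
     injective, and the values of mu with a nontrivial kernel are isolated.
   Finally, D - lam = (D - l0)(I - (lam - l0) Q), and the kernel of D - lam on
   its whole domain is spanned by phi_lam. *)

(** * Real-valued norms and convergence along a filter *)

Definition rnorm (R : realType) (V : normedZmodType R[i]) (x : V) : R :=
  complex.Re `|x|.

Section RealNorm.
Context (R : realType) (H : normedModType R[i]).
Implicit Types (x y : H) (a : R[i]).

(** A norm over [R[i]] is a nonnegative real element of [R[i]]; its real part loses nothing and
    brings estimates into the ordered field [R]. *)
Lemma rnormE (V : normedZmodType R[i]) (x : V) : `|x| = (rnorm x)%:C%C.
Proof. by rewrite /rnorm RRe_real ?normr_real. Qed.

Lemma rnorm_ge0 (V : normedZmodType R[i]) (x : V) : 0 <= rnorm x.
Proof. by rewrite -ler0c -rnormE. Qed.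

Lemma rnorm_eq0 (V : normedZmodType R[i]) (x : V) : (rnorm x == 0) = (x == 0).
Proof. by rewrite -[in RHS]normr_eq0 rnormE -(inj_eq (@complexI R)). Qed.

Lemma rnormD (V : normedZmodType R[i]) (x y : V) : rnorm (x + y) <= rnorm x + rnorm y.
Proof. by have := ler_normD x y; rewrite !rnormE -rmorphD lecR. Qed.

Lemma rnormN (V : normedZmodType R[i]) (x : V) : rnorm (- x) = rnorm x.
Proof. by rewrite /rnorm normrN. Qed.

Lemma rnormB (V : normedZmodType R[i]) (x y : V) : rnorm (x - y) <= rnorm x + rnorm y.
Proof. by rewrite -(rnormN y) rnormD. Qed.

Lemma rdistC (V : normedZmodType R[i]) (x y : V) : rnorm (x - y) = rnorm (y - x).
Proof. by rewrite /rnorm distrC. Qed.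

Lemma rnormZ a x : rnorm (a *: x) = rnorm a * rnorm x.
Proof. by have := normrZ a x; rewrite !rnormE -rmorphM => /complexI. Qed.

Lemma rnorm_real (r : R) : 0 <= r -> rnorm (r%:C%C : R[i]) = r.
Proof. by move=> r0; apply: complexI; rewrite -rnormE ger0_norm// ler0c. Qed.

Lemma rcvgP (T : Type) (F : set_system T) (FF : Filter F) (u : T -> H) (x : H) :
  u @ F --> x <-> forall e : R, 0 < e -> \forall k \near F, rnorm (x - u k) < e.
Proof.
split=> [/cvgrPdist_lt h e e0|h].
  have := h e%:C%C; rewrite ltcR => /(_ e0); apply: filterS => k.
  by rewrite rnormE ltcR.
apply/cvgrPdist_lt => e e0.
have eE : e = (complex.Re e)%:C%C by rewrite RRe_real// gtr0_real.
move: e0; rewrite eE ltcR => /h; apply: filterS => k.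
by rewrite rnormE ltcR.
Qed.

Lemma rcvg_near (T : Type) (F : set_system T) (FF : Filter F) (u : T -> H) (x : H) (e : R) :
  u @ F --> x -> 0 < e -> \forall k \near F, rnorm (x - u k) < e.
Proof. by move=> /rcvgP h; exact: h. Qed.

End RealNorm.

Definition ev_bounded (R : realType) (H : normedZmodType R[i])
    (U : set_system nat) (u : nat -> H) : Prop :=
  exists B : R, \forall k \near U, rnorm (u k) <= B.

Section EvBounded.
Context (R : realType) (H : normedModType R[i]) (U : set_system nat) (FU : Filter U).
Implicit Types u v : nat -> H.

Lemma ev_boundedD u v : ev_bounded U u -> ev_bounded U v ->
  ev_bounded U (fun k => u k + v k).
Proof.
move=> [B hB] [B' hB']; exists (B + B').
near=> k; apply: le_trans (rnormD _ _) _; apply: lerD; near: k => //.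
Unshelve. all: by end_near. Qed.

Lemma ev_boundedZ (a : R[i]) u : ev_bounded U u ->
  ev_bounded U (fun k => a *: u k).
Proof.
move=> [B hB]; exists (rnorm a * B); near=> k.
by rewrite rnormZ ler_wpM2l ?rnorm_ge0//; near: k.
Unshelve. all: by end_near. Qed.

Lemma cvg_ev_bounded u (x : H) : u @ U --> x -> ev_bounded U u.
Proof.
move=> /rcvg_near /(_ ltr01) h; exists (rnorm x + 1); near=> k.
rewrite -[u k](subKr x); apply: le_trans (rnormB _ _) _.
by rewrite lerD2l ltW//; near: k.
Unshelve. all: by end_near. Qed.

End EvBounded.

(** * Compactness along an ultrafilter *)

Section CompactOperator.
Context (R : realType) (H : completeNormedModType R[i]) (V : H -> H).
Hypothesis Vc : compact_op V.

Lemma compact_op0 : V 0 = 0.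
Proof. by have := Vc.1 1 0 0; rewrite !scale1r addr0 -{1}[V 0]addr0 => /addrI. Qed.

Lemma compact_opZ a x : V (a *: x) = a *: V x.
Proof. by have := Vc.1 a x 0; rewrite !addr0 compact_op0 addr0. Qed.

Lemma compact_opB x y : V (x - y) = V x - V y.
Proof. by rewrite addrC -scaleN1r Vc.1 scaleN1r addrC. Qed.

End CompactOperator.

Section Rellich.
Context (R : realType) (H : completeNormedModType R[i]).
Context (U : set_system nat) (UU : UltraFilter U).

(** The preimage of each set or of its complement belongs to [U], so no proper filter properly
    refines the image. *)
Lemma ultra_fmap (T : Type) (u : nat -> T) : UltraFilter (u @ U).
Proof.
have PU : ProperFilter U by exact: ultra_proper.
split; first exact: fmap_proper_filter.
move=> G PG sub; apply/seteqP; split=> // A GA.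
have [UA|UA] := in_ultra_setVsetC (u @^-1` A) UU; first exact: UA.
have /sub GnA : (u @ U) (~` A) by [].
by case: (@filter_not_empty _ G PG); rewrite -(setICr A); exact: filterI.
Qed.

(** Rescaling brings [u] eventually into the unit ball, whose image has compact closure, and
    ultrafilters on compact sets converge. No subsequence is extracted. *)
Lemma compact_op_cvg (V : H -> H) (u : nat -> H) :
  compact_op V -> ev_bounded U u -> exists p : H, (fun k => V (u k)) @ U --> p.
Proof.
move=> Vc [B hB]; have := Vc.2; rewrite compact_ultra => cV.
have PU : ProperFilter U by exact: ultra_proper.
pose b : R := `|B| + 1; have b0 : 0 < b by rewrite ltr_wpDl.
pose c : R[i] := (b^-1)%:C%C.
have c0 : c != 0 by rewrite gt_eqF// ltcR invr_gt0.
have [] := cV ((fun k => V (c *: u k)) @ U) (ultra_fmap _).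
  apply: (@filterS _ U _ _ _ _ hB) => k ukB /=; apply: subset_closure; exists (c *: u k) => //.
  rewrite -ball_normE /= sub0r normrN rnormE -[1]/(1%:C%C) ltcR rnormZ.
  rewrite rnorm_real ?invr_ge0 ?ltW// mulrC ltr_pdivrMr// mul1r /b.
  have := ler_norm B; lra.
move=> p [_ hp]; exists (c^-1 *: p).
rewrite (_ : (fun k => V (u k)) = (fun k => c^-1 *: V (c *: u k))).
  by apply: cvgZr.
by apply/funext => k; rewrite (compact_opZ Vc) scalerA mulVf// scale1r.
Qed.

(* [V (y - V (D y)) = c *: V phi0] is squeezed out of two applications of the
   compactness of [V], so the scalars [c] need no compactness of their own. *)
Lemma graph_bounded_cvg (dom : set H) (D V : H -> H) (phi0 : H) (y : nat -> H) :
  lin_op dom D -> compact_op V -> (forall x, dom (V x) /\ D (V x) = x) ->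
  phi0 != 0 ->
  (forall x, dom x -> D x = 0 -> exists c : R[i], x = c *: phi0) ->
  (forall k, dom (y k)) -> ev_bounded U y -> ev_bounded U (fun k => D (y k)) ->
  exists p : H, y @ U --> p.
Proof.
move=> [[dom0 domL] Dlin] Vc DV phi0n ker ydom yb Dyb.
have PU : ProperFilter U by exact: ultra_proper.
have D0 : D 0 = 0.
  by have := Dlin 1 0 0 dom0 dom0; rewrite !scale1r addr0 -{1}[D 0]addr0 => /addrI.
have kerk k : exists c : R[i], y k - V (D (y k)) = c *: phi0.
  have [d1 d2] := DV (D (y k)).
  apply: ker.
    by have := domL (-1) _ _ d1 (ydom k); rewrite scaleN1r addrC.
  by have := Dlin (-1) _ _ d1 (ydom k); rewrite !scaleN1r addrC d2 addNr.
have [c hc] := choice kerk.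
have [p hp] := compact_op_cvg Vc Dyb.
have [q hq] := compact_op_cvg Vc yb.
have [r hr] := compact_op_cvg Vc (cvg_ev_bounded _ hp).
pose w := V phi0.
have w0 : w != 0.
  apply: contra_neq phi0n => w0.
  by rewrite -(DV phi0).2 -/w w0 D0.
have cw : (fun k => c k *: w) @ U --> q - r.
  rewrite (_ : (fun k => c k *: w) = (fun k => V (y k) - V (V (D (y k))))).
    exact: cvgB.
  by apply/funext => k; rewrite -(compact_opB Vc) hc (compact_opZ Vc).
suff : cauchy (y @ U) by move=> /cauchy_cvg hcv; exists (lim (y @ U)).
apply: cauchy_exP => e e0.
have eE : e = (complex.Re e)%:C%C by rewrite RRe_real// gtr0_real.
move: e0; rewrite eE ltcR; set e' := complex.Re e => e0.
pose m := rnorm phi0 / rnorm w.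
have nw : 0 < rnorm w by rewrite lt_neqAle rnorm_ge0 eq_sym rnorm_eq0 w0.
have m0 : 0 <= m by rewrite divr_ge0 ?rnorm_ge0.
(* Up to [2 * d] comes from the terms [V (D (y k))] and up to [2 * d * m] from the kernel terms, [m]
   turning multiples of [w] into multiples of [phi0]; together this is half of [e']. *)
pose d := e' / (4 * (1 + m)).
have d0 : 0 < d by rewrite divr_gt0// mulr_gt0// ltr_wpDr.
have near1 : \forall k \near U, rnorm (p - V (D (y k))) < d /\ rnorm (q - r - c k *: w) < d.
  by apply: filterI; [exact: rcvg_near hp d0|exact: rcvg_near cw d0].
have [k0 [h1 h2]] := filter_ex near1.
exists (y k0); apply: filterS near1 => k [h3 h4] /=.
rewrite -ball_normE /= rnormE ltcR.
have -> : y k0 - y k = ((p - V (D (y k))) - (p - V (D (y k0)))) + (c k0 - c k) *: phi0.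
  rewrite scalerBl -!hc opprB [p - _ + _]addrC subrKA opprB.
  by rewrite [RHS]addrCA !subrKA.
have h5 : rnorm (c k0 - c k) * rnorm w < 2 * d.
  rewrite -rnormZ (_ : (_ - _) *: w = (q - r - c k *: w) - (q - r - c k0 *: w)).
    by apply: le_lt_trans (rnormB _ _) _; lra.
  by rewrite scalerBl opprB [RHS]addrC subrKA.
have h6 : rnorm (c k0 - c k) * rnorm phi0 <= 2 * d * m.
  rewrite /m mulrA ler_pdivlMr// mulrAC ler_wpM2r ?rnorm_ge0// ltW//.
have h7 := rnormD ((p - V (D (y k))) - (p - V (D (y k0)))) ((c k0 - c k) *: phi0).
have h8 := rnormB (p - V (D (y k))) (p - V (D (y k0))).
rewrite rnormZ in h7.
have h9 : 4 * d * (1 + m) = e'.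
  by rewrite mulrAC mulrC /d mulrVK ?unitfE// gt_eqF// mulr_gt0// ltr_wpDr.
have h10 := mulr_ge0 (ltW d0) m0.
clear -d0 h1 h3 h6 h7 h8 h9 h10; lra.
Unshelve. all: by end_near. Qed.

End Rellich.

(** * Subspaces and graph norms *)

Section Subspace.
Context (R : realType) (H : completeNormedModType R[i]) (J : set H).
Hypothesis Jsub : is_subspace J.

Lemma subspace0 : J 0. Proof. exact: Jsub.1. Qed.

Lemma subspaceD x y : J x -> J y -> J (x + y).
Proof. by move=> Jx Jy; rewrite -[x]scale1r; exact: Jsub.2. Qed.

Lemma subspaceZ a x : J x -> J (a *: x).
Proof. by move=> Jx; rewrite -[_ *: _]addr0; apply: Jsub.2 => //; exact: subspace0. Qed.

Lemma subspaceB x y : J x -> J y -> J (x - y).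
Proof. by move=> Jx Jy; rewrite -scaleN1r; apply: subspaceD => //; exact: subspaceZ. Qed.

End Subspace.

(** Estimates use these norms instead of the metric of C^oo(D). Order [p] itself is included, so
    that [p = 0] gives the norm of [H]. *)
Definition graph_norm (R : realType) (H : completeNormedModType R[i])
  (D : H -> H) (p : nat) (x : H) : R := \sum_(j < p.+1) rnorm (iter j D x).

Section GraphNorm.
Context (R : realType) (H : completeNormedModType R[i]) (D : H -> H).
Local Notation N := (graph_norm D).

Lemma graph_norm0n x : N 0 x = rnorm x.
Proof. by rewrite /graph_norm big_ord_recl big_ord0 addr0. Qed.

Lemma graph_normS p x : N p.+1 x = N p x + rnorm (iter p.+1 D x).
Proof. by rewrite /graph_norm big_ord_recr. Qed.

Lemma rnorm_le_graph_norm p j x : (j <= p)%N -> rnorm (iter j D x) <= N p x.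
Proof.
move=> jp; rewrite /graph_norm.
have jp' : (j < p.+1)%N by [].
rewrite (bigD1 (Ordinal jp'))//= lerDl sumr_ge0// => i _; exact: rnorm_ge0.
Qed.

Lemma graph_norm_ge0 p x : 0 <= N p x.
Proof. by apply: sumr_ge0 => i _; exact: rnorm_ge0. Qed.

Lemma graph_norm_mono p q x : (p <= q)%N -> N p x <= N q x.
Proof.
elim: q => [|q IH]; first by rewrite leqn0 => /eqP->.
rewrite leq_eqVlt => /predU1P[->//|]; rewrite ltnS => /IH h.
by rewrite graph_normS; apply: le_trans h _; rewrite lerDl rnorm_ge0.
Qed.

Section OnSubspace.
Context (J : set H) (dom : set H).
Hypotheses (Dlin : linear_on dom D) (Jdom : J `<=` dom)
  (Jsub : is_subspace J) (JD : forall x, J x -> J (D x)).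

Lemma iter_stable j x : J x -> J (iter j D x).
Proof. by move=> Jx; elim: j => //= j; exact: JD. Qed.

Lemma iter_linear j a x y : J x -> J y ->
  iter j D (a *: x + y) = a *: iter j D x + iter j D y.
Proof.
move=> Jx Jy; elim: j => //= j ->.
by rewrite Dlin//; apply: Jdom; exact: iter_stable.
Qed.

Lemma iter_add j x y : J x -> J y -> iter j D (x + y) = iter j D x + iter j D y.
Proof. by move=> Jx Jy; rewrite -[x]scale1r iter_linear// !scale1r. Qed.

Lemma iter_sub j x y : J x -> J y -> iter j D (x - y) = iter j D x - iter j D y.
Proof.
by move=> Jx Jy; rewrite addrC -scaleN1r iter_linear// scaleN1r addrC.
Qed.

Lemma iter_zero j : iter j D 0 = 0.
Proof. by have := iter_sub j (subspace0 Jsub) (subspace0 Jsub); rewrite !subrr. Qed.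

Lemma iter_scale j a x : J x -> iter j D (a *: x) = a *: iter j D x.
Proof.
move=> Jx; have := iter_linear j a Jx (subspace0 Jsub).
by rewrite iter_zero !addr0.
Qed.

Lemma graph_normD p x y : J x -> J y -> N p (x + y) <= N p x + N p y.
Proof.
move=> Jx Jy; rewrite -big_split/=; apply: ler_sum => i _.
by rewrite iter_add// rnormD.
Qed.

Lemma graph_normZ p a x : J x -> N p (a *: x) = rnorm a * N p x.
Proof.
move=> Jx; rewrite mulr_sumr; apply: eq_bigr => i _.
by rewrite iter_scale// rnormZ.
Qed.

Lemma graph_dist p x y : J x -> J y -> N p (x - y) = N p (y - x).
Proof.
move=> Jx Jy; apply: eq_bigr => i _.
by rewrite !iter_sub// rdistC.
Qed.

Lemma graph_normB p x y : J x -> J y -> N p (x - y) <= N p x + N p y.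
Proof.
move=> Jx Jy; rewrite -big_split/=; apply: ler_sum => i _.
by rewrite iter_sub// rnormB.
Qed.

(** The Riesz lemma: [v] is taken within twice the distance from [v0] to [M], and [v0 - v] is
    normalised. The positive [d] stands in for closedness of [M]. *)
Lemma graph_riesz p (M : set H) (v0 : H) (d : R) :
  is_subspace M -> M `<=` J -> J v0 -> 0 < d ->
  (forall v, M v -> d <= N p (v0 - v)) ->
  exists (a : R[i]) (v : H), [/\ M v, N p (a *: (v0 - v)) = 1 &
    forall w, M w -> 2^-1 <= N p (a *: (v0 - v) - w)].
Proof.
move=> Msub MJ Jv0 d0 hd.
pose E := [set N p (v0 - v) | v in M].
have Elb : lbound E d by move=> _ [v Mv <-]; exact: hd.
have E0 : E !=set0 by exists (N p (v0 - 0)), 0 => //; exact: Msub.1.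
have Einf : has_inf E by split => //; exists d.
have dE : d <= inf E by exact: lb_le_inf.
have i0 : 0 < inf E := lt_le_trans d0 dE.
have [_ [v Mv <-] hv] := inf_adherent i0 Einf.
set r := N p (v0 - v) in hv.
have r0 : 0 < r := lt_le_trans d0 (hd _ Mv).
have rE : rnorm ((r^-1)%:C%C : R[i]) = r^-1 by rewrite rnorm_real// invr_ge0 ltW.
have rc0 : ((r^-1)%:C%C : R[i]) != 0 by rewrite gt_eqF// ltcR invr_gt0.
have Jv := MJ _ Mv.
exists (r^-1)%:C%C, v; split => //.
  by rewrite graph_normZ ?rE ?mulVf// ?gt_eqF//; exact: subspaceB.
move=> w Mw; set a := (r^-1)%:C%C.
have -> : a *: (v0 - v) - w = a *: (v0 - (v + a^-1 *: w)).
  by rewrite opprD addrA [RHS]scalerBr scalerA mulfV// scale1r.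
have Mv' : M (v + a^-1 *: w) by apply: subspaceD => //; exact: subspaceZ.
rewrite graph_normZ ?rE; last by apply: subspaceB => //; exact: MJ.
rewrite mulrC ler_pdivlMr// mulrC.
have h : inf E <= N p (v0 - (v + a^-1 *: w)) by apply: ge_inf; [exists d|exists (v + a^-1 *: w)].
by apply: le_trans h; rewrite ler_pdivrMr//; move: hv; clear; lra.
Qed.

End OnSubspace.
End GraphNorm.

Lemma graph_closed (R : realType) (H : completeNormedModType R[i])
    (U : set_system nat) (PU : ProperFilter U) (dom : set H) (D : H -> H)
    (u : nat -> H) (x w : H) :
  closed_op dom D -> (forall k, dom (u k)) ->
  u @ U --> x -> (fun k => D (u k)) @ U --> w -> dom x /\ w = D x.
Proof.
move=> clD du ux Duw.
have h : (fun k => (u k, D (u k))) @ U --> (x, w) by exact: cvg_pair.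
by have [] := closed_cvg _ clD _ _ h; first by apply: nearW => k /=.
Qed.

(** * Limits along the ultrafilter that stay in J *)

Section Bounded.
Context (R : realType) (H : completeNormedModType R[i]).
Context (U : set_system nat) (UU : UltraFilter U).
Hypothesis Ufree : \oo `<=` U.
Context (dom : set H) (D : H -> H) (J : set H).
Hypotheses (domS : is_subspace dom) (Dlin : linear_on dom D) (Dclosed : closed_op dom D).
Hypothesis Drellich : forall y : nat -> H, (forall k, dom (y k)) ->
  ev_bounded U y -> ev_bounded U (fun k => D (y k)) -> exists p : H, y @ U --> p.
Hypotheses (JC : J `<=` Cinf dom D) (Jsub : is_subspace J)
  (JD : forall x, J x -> J (D x)).
(** Each order [p] may have its own approximating sequence [v p]; no single sequence has to converge
    in all orders. *)
Hypothesis Jclosed : forall (x : H) (v : nat -> nat -> H),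
  Cinf dom D x -> (forall p k, J (v p k)) ->
  (forall p j, (j <= p)%N -> (fun k => iter j D (v p k)) @ U --> iter j D x) -> J x.

Local Notation N := (graph_norm D).

Let PU : ProperFilter U. Proof. exact: ultra_proper. Qed.

Let Jdom : J `<=` dom. Proof. by move=> x /JC /(_ 0%N). Qed.

(** The Rellich property makes each iterate converge, at the cost of a bound one order higher, and
    closedness of [D] identifies the limits. *)
Lemma iter_cvg (u : nat -> H) (x : H) (j : nat) :
  (forall k, J (u k)) -> u @ U --> x ->
  (forall i, (i <= j.+1)%N -> ev_bounded U (fun k => iter i D (u k))) ->
  (fun k => iter j D (u k)) @ U --> iter j D x /\
  (forall i, (i < j)%N -> dom (iter i D x)).
Proof.
move=> Ju ux; elim: j => [//|j IH] hb.
have [|h1 h2] := IH; first by move=> i ij; apply: hb; exact: leqW.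
have [w hw] : exists w : H, (fun k => iter j.+1 D (u k)) @ U --> w.
  apply: Drellich => [k||].
  - by apply: Jdom; exact: iter_stable.
  - exact: hb.
  - exact: (hb j.+2).
have [d1 wE] : dom (iter j D x) /\ w = D (iter j D x).
  apply: (graph_closed PU Dclosed _ h1 hw) => k.
  by apply: Jdom; exact: iter_stable.
split; first by rewrite /= -wE.
by move=> i; rewrite ltnS leq_eqVlt => /predU1P[->//|]; exact: h2.
Qed.

Lemma graph_norm_ev_bounded p (u : nat -> H) (B : R) :
  (\forall k \near U, N p (u k) <= B) ->
  forall i, (i <= p)%N -> ev_bounded U (fun k => iter i D (u k)).
Proof.
move=> hB i ip; exists B; apply: filterS hB => k.
exact/le_trans/rnorm_le_graph_norm.
Qed.

(** A bound in [N m] yields convergence below order [m] only, so the orders are supplied by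
    different sequences with the same limit [x]. *)
Lemma mem_of_bounded_approx (x : H) (u : nat -> nat -> H) :
  (forall m k, J (u m k)) -> (forall m, u m @ U --> x) ->
  (forall m, exists B, \forall k \near U, N m (u m k) <= B) -> J x.
Proof.
move=> Ju ux ub.
have h j : (fun k => iter j D (u j.+1 k)) @ U --> iter j D x /\
  (forall i, (i < j)%N -> dom (iter i D x)).
  apply: iter_cvg => //; have [B hB] := ub j.+1.
  exact: graph_norm_ev_bounded hB.
apply: (@Jclosed x (fun p => u p.+1)) => // [n|p j jp]; first exact: (h n.+1).2.
have [B hB] := ub p.+1.
apply: (iter_cvg _ _ _).1 => // i ij.
by apply: (graph_norm_ev_bounded hB); lia.
Qed.

(** * Boundedness of the inverse Q of D - l0 on J *)

Section Inverse.
Context (l0 : R[i]) (Q : H -> H).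
Hypothesis inj0 : forall x y, J x -> J y ->
  D x - l0 *: x = D y - l0 *: y -> x = y.
Hypothesis JQ : forall y, J y -> J (Q y).
Hypothesis DQ : forall y, J y -> D (Q y) - l0 *: Q y = y.

Lemma DQE y : J y -> D (Q y) = y + l0 *: Q y.
Proof. by move=> Jy; rewrite -{2}(DQ Jy) subrK. Qed.

Lemma inverse_linear a x y : J x -> J y -> Q (a *: x + y) = a *: Q x + Q y.
Proof.
move=> Jx Jy.
have Jxy : J (a *: x + y) by exact: Jsub.2.
have JQxy : J (a *: Q x + Q y) by apply: Jsub.2; exact: JQ.
apply: inj0 => //; first exact: JQ.
rewrite DQ// Dlin ?DQE//; try by apply: Jdom; exact: JQ.
by rewrite !scalerDr !scalerA [l0 * a]mulrC [X in X - _]addrACA addrK.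
Qed.

Lemma inverse_scale a x : J x -> Q (a *: x) = a *: Q x.
Proof.
have J0 := subspace0 Jsub.
have Q0 : Q 0 = 0.
  by have := inverse_linear 1 J0 J0; rewrite !scale1r addr0 -{1}[Q 0]addr0 => /addrI.
by move=> Jx; have := inverse_linear a Jx J0; rewrite Q0 !addr0.
Qed.

Lemma inverse_sub x y : J x -> J y -> Q (x - y) = Q x - Q y.
Proof.
by move=> Jx Jy; rewrite addrC -scaleN1r inverse_linear// scaleN1r addrC.
Qed.

(** Compactness takes the place of an open mapping theorem on the Frechet space [J]: a failure for
    every [n] would produce an eigenvector for [l0] in [J]. *)
Lemma inverse_bounded0 : exists n (C : R), 0 <= C /\
  forall x, J x -> rnorm (Q x) <= C * N n x.
Proof.
apply: contrapT => hn.
have ex n : exists x, J x /\ n.+1%:R * N n x < rnorm (Q x).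
  apply: contrapT => hx; apply: hn; exists n, n.+1%:R; split => // x Jx.
  by rewrite leNgt; apply/negP => h; apply: hx; exists x.
have [X hX] := choice ex.
have JX n : J (X n) := (hX n).1.
pose r n := rnorm (Q (X n)).
have r0 n : 0 < r n.
  by apply: le_lt_trans (hX n).2; rewrite mulr_ge0 ?graph_norm_ge0.
pose c n : R[i] := ((r n)^-1)%:C%C.
have rc n : rnorm (c n) = (r n)^-1 by rewrite rnorm_real// invr_ge0 ltW.
pose x n := c n *: X n.
pose y n := c n *: Q (X n).
have Jx n : J (x n) by exact: subspaceZ.
have Jy n : J (y n) by apply: subspaceZ => //; exact: JQ.
have y1 n : rnorm (y n) = 1 by rewrite rnormZ rc mulVf// gt_eqF.
have Dy n : D (y n) = l0 *: y n + x n.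
  by rewrite /y -inverse_scale// (DQE (Jx n)) addrC.
have Nx n : N n (x n) < n.+1%:R^-1.
  rewrite (graph_normZ Dlin Jdom)// rc ltr_pdivrMl// mulrC.
  by rewrite ltr_pdivlMl//; exact: (hX n).2.
(* For [k >= j] the order [j] is dominated by [N k (x k)], hence by [1 / (k + 1)]; freeness of [U]
   carries this over. *)
have x0 j : (fun k => iter j D (x k)) @ U --> (0 : H).
  apply/rcvgP => e e0.
  have : \forall k \near \oo, rnorm (0 - iter j D (x k)) < e.
    near=> k; rewrite sub0r rnormN.
    have kj : (j <= k)%N by near: k; exact: nbhs_infty_ge.
    apply: le_lt_trans (rnorm_le_graph_norm _ _ kj) _.
    apply: lt_trans (Nx k) _; near: k.
    exact: (near_infty_natSinv_lt (PosNum e0)).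
  exact: Ufree.
have yb : ev_bounded U y by exists 1; apply: nearW => k; rewrite y1.
have [z hz] : exists z : H, y @ U --> z.
  apply: Drellich => //; first by move=> k; exact: Jdom.
  rewrite (_ : (fun k => D (y k)) = (fun k => l0 *: y k + x k)).
    apply: ev_boundedD; first exact: ev_boundedZ.
    exact: cvg_ev_bounded (x0 0%N).
  exact/funext.
(* [D] acts on [y k] as [l0] up to [x k], which vanishes in every order; hence [D z = l0 *: z], and
   the iterates of [z] are limits too. *)
have yz j : (fun k => iter j D (y k)) @ U --> l0 ^+ j *: z.
  elim: j => [|j IH]; first by rewrite expr0 scale1r.
  rewrite (_ : (fun k => _) = (fun k => l0 *: iter j D (y k) + iter j D (x k))).
    rewrite exprS -scalerA -[_ *: (_ *: _)]addr0.
    by apply: cvgD; [exact: cvgZr|exact: x0].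
  by apply/funext => k; rewrite iterSr Dy (iter_linear Dlin Jdom).
have [dz Dz] : dom z /\ l0 *: z = D z.
  apply: (graph_closed PU Dclosed _ hz); first by move=> k; exact: Jdom.
  by have := yz 1%N; rewrite expr1.
have iz j : iter j D z = l0 ^+ j *: z /\ dom (iter j D z).
  elim: j => [|j [IH IHd]]; first by rewrite expr0 scale1r.
  suff E : iter j.+1 D z = l0 ^+ j.+1 *: z by rewrite E; split => //; exact: subspaceZ.
  have D0 : D 0 = 0 := iter_zero Dlin Jdom Jsub JD 1.
  have := Dlin (l0 ^+ j) dz domS.1.
  by rewrite /= IH D0 !addr0 => ->; rewrite -Dz scalerA -exprSr.
have Jz : J z.
  apply: (@Jclosed z (fun _ => y)) => // [j|p j _]; first exact: (iz j).2.
  by rewrite (iz j).1.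
have z0 : z = 0.
  apply: inj0 => //; first exact: subspace0.
  have D0 : D 0 = 0 := iter_zero Dlin Jdom Jsub JD 1.
  by rewrite -Dz subrr D0 scaler0 subr0.
have [k] := filter_ex (rcvg_near _ hz ltr01).
by rewrite z0 sub0r rnormN y1 ltxx.
Unshelve. all: by end_near. Qed.

(** The relation [D (Q x) = x + l0 *: Q x] trades the top order of [Q x] for one order less of [Q x]
    and of [x]. *)
Lemma inverse_bounded : exists n, forall m, exists C : R, 0 <= C /\
  forall x, J x -> N (n + m).+1 (Q x) <= C * N (n + m) x.
Proof.
have [n [C0 [C00 hC0]]] := inverse_bounded0; exists n => m.
(* Induction on the order [i] on the left: [N n] suffices at first, and beyond it order [i] costs
   order [i - 1]. At [i = n + m + 1] the maximum is [n + m]. *)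
have [C [C_ge0 hC]] : exists C : R, 0 <= C /\
    forall x, J x -> N (n + m).+1 (Q x) <= C * N (maxn n (n + m).+1.-1) x.
  elim: (n + m).+1 => [|i [C [C_ge0 hC]]].
    by exists C0; split => // x Jx; rewrite graph_norm0n maxn0; exact: hC0.
  exists (C + 1 + rnorm l0 * C); split => [|x Jx].
    by rewrite !addr_ge0// mulr_ge0// rnorm_ge0.
  rewrite graph_normS iterSr DQE//.
  have -> : iter i D (x + l0 *: Q x) = l0 *: iter i D (Q x) + iter i D x.
    by rewrite addrC (iter_linear Dlin Jdom)//; exact: JQ.
  have h1 : N i (Q x) <= C * N (maxn n i) x.
    apply: le_trans (hC _ Jx) _; apply: ler_wpM2l => //.
    by apply: graph_norm_mono; rewrite geq_max leq_maxl/= leq_max leq_pred orbT.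
  have h2 : rnorm (iter i D x) <= N (maxn n i) x.
    by apply: rnorm_le_graph_norm; exact: leq_maxr.
  have h3 : rnorm (l0 *: iter i D (Q x)) <= rnorm l0 * (C * N (maxn n i) x).
    rewrite rnormZ; apply: ler_wpM2l; first exact: rnorm_ge0.
    exact: le_trans (rnorm_le_graph_norm _ _ (leqnn i)) h1.
  rewrite -addrA mulrDl mulrDl mul1r -mulrA.
  have h4 := rnormD (l0 *: iter i D (Q x)) (iter i D x).
  apply: le_trans (lerD h1 h4) _; rewrite lerD2l [X in _ <= X]addrC; exact: lerD.
exists C; split => // x Jx; apply: le_trans (hC _ Jx) _.
by rewrite (maxn_idPr _)// leq_addr.
Qed.

(** * Riesz theory of Q for the norm N n *)

Section Riesz.
Context (n : nat).
Hypothesis Qb : forall m, exists C : R, 0 <= C /\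
  forall x, J x -> N (n + m).+1 (Q x) <= C * N (n + m) x.

(** Compactness of [Q] in [N n]: the order gained by [Q] is spent on the Rellich property. The
    limits are vectors of [H] that need not lie in [J]. *)
Lemma inverse_graph_cvg (x : nat -> H) (B : R) : (forall k, J (x k)) ->
  (\forall k \near U, N n (x k) <= B) ->
  forall j, (j <= n)%N -> exists z : H, (fun k => iter j D (Q (x k))) @ U --> z.
Proof.
move=> Jx xB j jn; have [C [C0 hC]] := Qb 0; rewrite addn0 in hC.
have Qxb : \forall k \near U, N n.+1 (Q (x k)) <= C * B.
  by apply: filterS xB => k hk; apply: le_trans (hC _ (Jx k)) _; exact: ler_wpM2l.
apply: Drellich => [k||].
- by apply: Jdom; apply: iter_stable => //; exact: JQ.
- by apply: (graph_norm_ev_bounded Qxb); exact: leqW.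
- exact: (graph_norm_ev_bounded Qxb (i := j.+1)).
Qed.

Lemma graph_norm_near p (u : nat -> H) (x : H) :
  J x -> (forall k, J (u k)) ->
  (forall j, (j <= p)%N -> (fun k => iter j D (u k)) @ U --> iter j D x) ->
  forall e, 0 < e -> \forall k \near U, N p (x - u k) < e.
Proof.
move=> Jx Ju h e e0.
have e'0 : 0 < e / p.+1%:R by rewrite divr_gt0.
have : \forall k \near U, forall j : 'I_p.+1, rnorm (iter j D x - iter j D (u k)) < e / p.+1%:R.
  by apply: filter_forall => j; apply: rcvg_near (h _ _) e'0; rewrite -ltnS.
apply: filterS => k hk.
rewrite /graph_norm (_ : e = \sum_(j < p.+1) e / p.+1%:R).
  apply: ltr_sum => [|j _]; first by apply/hasP; exists ord0 => //; rewrite mem_index_enum.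
  by rewrite (iter_sub Dlin Jdom).
by rewrite sumr_const card_ord -[RHS]mulr_natr mulfVK.
Qed.

(** This form of compactness ends both Riesz arguments: some two images are close because their
    iterates up to order [n] all converge along [U]. *)
Lemma inverse_no_separated (x : nat -> H) (B d : R) : (forall k, J (x k)) ->
  (forall k, N n (x k) <= B) -> 0 < d ->
  ~ (forall k l, (l < k)%N -> d <= N n (Q (x k) - Q (x l))).
Proof.
move=> Jx xB d0 hd.
have JQx k : J (Q (x k)) by exact: JQ.
have hz (j : 'I_n.+1) : exists z : H, (fun k => iter j D (Q (x k))) @ U --> z.
  apply: (@inverse_graph_cvg x B) => //; first exact: nearW.
  by rewrite -ltnS.
have [z hzz] := choice hz.
pose e := d / 2 / n.+1%:R.
have e0 : 0 < e by rewrite !divr_gt0.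
have near1 : \forall k \near U, forall j : 'I_n.+1, rnorm (z j - iter j D (Q (x k))) < e.
  by apply: filter_forall => j; exact: rcvg_near (hzz j) e0.
have [l hl] := filter_ex near1.
have near2 : \forall k \near U, (l < k)%N by apply: Ufree; exact: nbhs_infty_gt.
have [k [lk hk]] := filter_ex (filterI near2 near1).
have := hd _ _ lk; rewrite leNgt => /negP; apply.
rewrite /graph_norm (_ : d = \sum_(j < n.+1) 2 * e).
  apply: ltr_sum => [|j _]; first by apply/hasP; exists ord0 => //; rewrite mem_index_enum.
  rewrite (iter_sub Dlin Jdom)//.
  rewrite (_ : _ - _ = (z j - iter j D (Q (x l))) - (z j - iter j D (Q (x k)))).
    by apply: le_lt_trans (rnormB _ _) _; have := hl j; have := hk j; lra.
  by rewrite opprB [RHS]addrC subrKA.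
rewrite sumr_const card_ord -[RHS]mulr_natr /e mulrA mulfVK// mulrC mulfVK//.
Qed.

Definition shift (mu : R[i]) (x : H) : H := x - mu *: Q x.
Local Notation S := shift.

Lemma shift_mem mu x : J x -> J (S mu x).
Proof. by move=> Jx; apply: subspaceB => //; apply: subspaceZ => //; exact: JQ. Qed.

Lemma shift_linear mu a x y : J x -> J y ->
  S mu (a *: x + y) = a *: S mu x + S mu y.
Proof.
move=> Jx Jy; rewrite /shift inverse_linear// scalerBr scalerDr !scalerA [mu * a]mulrC.
by rewrite opprD addrACA.
Qed.

Lemma shift_sub mu x y : J x -> J y -> S mu (x - y) = S mu x - S mu y.
Proof.
by move=> Jx Jy; rewrite addrC -scaleN1r shift_linear// scaleN1r addrC.
Qed.

Lemma shift_scale mu a x : J x -> S mu (a *: x) = a *: S mu x.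
Proof.
by move=> Jx; rewrite /shift inverse_scale// scalerBr !scalerA [mu * a]mulrC.
Qed.

Lemma shift0 mu : S mu 0 = 0.
Proof.
have := shift_scale mu 0 (subspace0 Jsub); rewrite !scale0r; exact.
Qed.

Lemma inverse_graph_bounded : exists C : R, 0 <= C /\
  forall x, J x -> N n (Q x) <= C * N n x.
Proof.
have [C [C0 hC]] := Qb 0; rewrite addn0 in hC; exists C; split => // x Jx.
by apply: le_trans (hC _ Jx); apply: graph_norm_mono.
Qed.

Lemma shift_graph_bounded mu : exists K : R, 0 <= K /\
  forall x, J x -> N n (S mu x) <= K * N n x.
Proof.
have [C [C0 hC]] := inverse_graph_bounded.
exists (1 + rnorm mu * C); split => [|x Jx].
  by rewrite addr_ge0// mulr_ge0// rnorm_ge0.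
have JQx := JQ Jx.
apply: le_trans (graph_normB Dlin Jdom JD _ _ _) _ => //; first exact: subspaceZ.
rewrite (graph_normZ Dlin Jdom)// mulrDl mul1r lerD2l -mulrA.
by apply: ler_wpM2l; [exact: rnorm_ge0|exact: hC].
Qed.

Lemma cvg_of_close (a b : nat -> H) (z : H) :
  (forall e, 0 < e -> \forall k \near U, rnorm (a k - b k) < e) ->
  a @ U --> z -> b @ U --> z.
Proof.
move=> ab az; apply/rcvgP => e e0; have e20 : 0 < e / 2 by rewrite divr_gt0.
near=> k.
have -> : z - b k = (z - a k) + (a k - b k) by rewrite subrKA.
apply: le_lt_trans (rnormD _ _) _; rewrite [e]splitr; apply: ltrD; near: k.
  exact: rcvg_near az e20.
exact: ab.
Unshelve. all: by end_near. Qed.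

(* The iterates [y + mu *: Q (y + mu *: Q (...))] of [x k] stay close to [x k] in
   the [n]-th graph norm while each application of [Q] gains one order of
   boundedness; this puts the limit into [J]. *)
Lemma approx_solution (mu : R[i]) (x : nat -> H) (B : R) (y : H) :
  (forall k, J (x k)) -> (forall k, N n (x k) <= B) -> J y ->
  (forall e, 0 < e -> \forall k \near U, N n (S mu (x k) - y) < e) ->
  exists z, [/\ J z, S mu z = y &
    forall e, 0 < e -> \forall k \near U, N n (z - x k) < e].
Proof.
move=> Jx xB Jy Sxy.
have [z0 hz0] : exists z0 : H, (fun k => Q (x k)) @ U --> z0.
  by apply: (@inverse_graph_cvg x B _ _ 0%N) => //; exact: nearW.
pose z := y + mu *: z0.
pose u m k := iter m (fun v => y + mu *: Q v) (x k).
have Ju m k : J (u m k).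
  elim: m => [|m IH]; first exact: Jx.
  by apply: subspaceD => //; apply: subspaceZ => //; exact: JQ.
have ub m : exists B', forall k, N (n + m) (u m k) <= B'.
  elim: m => [|m [B' hB']]; first by exists B => k; rewrite addn0.
  have [C [C0 hC]] := Qb m.
  exists (N (n + m.+1) y + rnorm mu * (C * B')) => k.
  have JQu := JQ (Ju m k).
  apply: le_trans (graph_normD Dlin Jdom JD _ _ _) _ => //; first exact: subspaceZ.
  rewrite lerD2l (graph_normZ Dlin Jdom)// addnS; apply: ler_wpM2l.
    exact: rnorm_ge0.
  by apply: le_trans (hC _ (Ju m k)) _; exact: ler_wpM2l.
(* The first difference is the given error [S mu (x k) - y], and each later one is [mu *: Q] of its
   predecessor, so boundedness of [Q] in [N n] keeps them small. *)
have udiff m e : 0 < e -> \forall k \near U, N n (u m k - u m.+1 k) < e.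
  elim: m e => [|m IH] e e0.
    apply: filterS (Sxy e e0) => k; congr (N n _ < e).
    by rewrite /u /shift /= opprD addrA addrAC.
  have [C [C0 hC]] := inverse_graph_bounded.
  have K0 : 0 < rnorm mu * C + 1 by rewrite ltr_wpDl// mulr_ge0// rnorm_ge0.
  have e'0 : 0 < e / (rnorm mu * C + 1) by rewrite divr_gt0.
  apply: filterS (IH _ e'0) => k hk.
  have -> : u m.+1 k - u m.+2 k = mu *: Q (u m k - u m.+1 k).
    rewrite inverse_sub// scalerBr [u m.+1 k in LHS]/= -/(u m k) [u m.+2 k]/= -/(u m.+1 k).
    by rewrite opprD addrACA subrr add0r.
  rewrite (graph_normZ Dlin Jdom Jsub JD); last by apply: JQ; exact: subspaceB.
  apply: (@le_lt_trans _ _ (rnorm mu * C * N n (u m k - u m.+1 k))).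
    rewrite -mulrA; apply: ler_wpM2l; first exact: rnorm_ge0.
    by apply: hC; exact: subspaceB.
  rewrite ltr_pdivlMr// in hk; apply: le_lt_trans hk.
  by rewrite mulrC ler_wpM2l ?graph_norm_ge0// lerDl.
have uclose m e : 0 < e -> \forall k \near U, rnorm (u m k - u m.+1 k) < e.
  move=> e0; apply: filterS (udiff m e e0) => k; apply: le_lt_trans.
  exact: (@rnorm_le_graph_norm _ _ D n 0 (u m k - u m.+1 k) isT).
have uz m : u m @ U --> z.
  elim: m => [|m IH]; last exact: cvg_of_close (uclose m) IH.
  have u1 : u 1%N @ U --> z by apply: cvgD; [exact: cvg_cst|exact: cvgZr].
  apply: cvg_of_close u1 => e e0; apply: filterS (uclose 0%N e e0) => k.
  by rewrite rdistC.
have Jz : J z.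
  apply: (mem_of_bounded_approx Ju uz) => m; have [B' hB'] := ub m.
  exists B'; apply: nearW => k; apply: le_trans (hB' k).
  by apply: graph_norm_mono; exact: leq_addl.
(* [x k] is bounded in [N n] only; the detour through [u 1], bounded in [N n.+1], gives convergence
   in [N n]. *)
have zx e : 0 < e -> \forall k \near U, N n (z - x k) < e.
  move=> e0; have e20 : 0 < e / 2 by rewrite divr_gt0.
  have zu1 : \forall k \near U, N n (z - u 1%N k) < e / 2.
    apply: graph_norm_near => // j jn.
    have [B' hB'] := ub 1%N; rewrite addn1 in hB'.
    apply: (iter_cvg (Ju 1%N) (uz 1%N) _).1 => i ij.
    have hU : \forall k \near U, N n.+1 (u 1%N k) <= B' by exact: nearW.
    by apply: (graph_norm_ev_bounded hU); exact: leq_trans ij _.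
  apply: filterS (filterI zu1 (udiff 0%N _ e20)) => k [h1 h2].
  have -> : z - x k = (z - u 1%N k) - (u 0%N k - u 1%N k).
    by rewrite opprB subrKA.
  apply: le_lt_trans (graph_normB Dlin Jdom JD _ _ _) _; try exact: subspaceB.
  by rewrite [e]splitr; exact: ltrD.
exists z; split => //.
apply/eqP; rewrite -subr_eq0 -rnorm_eq0 eq_le rnorm_ge0 andbT.
pose r := N n (S mu z - y).
apply: (@le_trans _ _ r); first exact: (@rnorm_le_graph_norm _ _ D n 0 (S mu z - y) isT).
rewrite leNgt; apply/negP => r0.
have [K [K0 hK]] := shift_graph_bounded mu.
(* This radius [e] satisfies [K * e + e = r]: one share for [z - x k] carried through [S mu], one
   for the residual of [x k]. *)
have e0 : 0 < r / (K + 1) by rewrite divr_gt0// ltr_wpDl.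
have [k [h1 h2]] := filter_ex (filterI (zx _ e0) (Sxy _ e0)).
have : r < r.
  have E : S mu z - y = S mu (z - x k) + (S mu (x k) - y).
    by rewrite shift_sub// subrKA.
  rewrite {1}/r E.
  have JS : J (S mu (z - x k)) by apply: shift_mem; exact: subspaceB.
  apply: le_lt_trans (graph_normD Dlin Jdom JD _ _ _) _ => //.
    by apply: subspaceB => //; exact: shift_mem.
  apply: le_lt_trans (lerD (hK _ _) (lexx _)) _; first exact: subspaceB.
  have := ler_wpM2l K0 (ltW h1); move: h2; set e := r / (K + 1) => h2 h3.
  have <- : K * e + e = r by rewrite -[X in _ + X]mul1r -mulrDl mulrC mulfVK// gt_eqF// ltr_wpDl.
  exact: ler_ltD.
by rewrite ltxx.
Qed.

(** * Injectivity of I - mu Q forces surjectivity *)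

Section Injective.
Context (mu : R[i]).
Hypothesis Sinj : forall x, J x -> S mu x = 0 -> x = 0.

(** Otherwise vectors of norm one with images tending to 0 would approach, by [approx_solution], a
    kernel vector of norm one in [J]. *)
Lemma shift_bounded_below : exists c : R, 0 <= c /\
  forall x, J x -> N n x <= c * N n (S mu x).
Proof.
apply: contrapT => hc.
have ex k : exists x, J x /\ k.+1%:R * N n (S mu x) < N n x.
  apply: contrapT => hx; apply: hc; exists k.+1%:R; split => // x Jx.
  by rewrite leNgt; apply/negP => h; apply: hx; exists x.
have [X hX] := choice ex.
have JX k : J (X k) := (hX k).1.
pose r k := N n (X k).
have r0 k : 0 < r k.
  by apply: le_lt_trans (hX k).2; rewrite mulr_ge0 ?graph_norm_ge0.
pose c k : R[i] := ((r k)^-1)%:C%C.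
have rc k : rnorm (c k) = (r k)^-1 by rewrite rnorm_real// invr_ge0 ltW.
pose x k := c k *: X k.
have Jx k : J (x k) by exact: subspaceZ.
have x1 k : N n (x k) = 1.
  by rewrite (graph_normZ Dlin Jdom)// rc mulVf// gt_eqF.
have Sx e : 0 < e -> \forall k \near U, N n (S mu (x k) - 0) < e.
  move=> e0; have : \forall k \near \oo, N n (S mu (x k) - 0) < e.
    near=> k; rewrite subr0 shift_scale// (graph_normZ Dlin Jdom)//; last exact: shift_mem.
    rewrite rc; apply: (@lt_trans _ _ k.+1%:R^-1).
      rewrite ltr_pdivrMl// ltr_pdivlMr// mulrC.
      exact: (hX k).2.
    near: k; exact: (near_infty_natSinv_lt (PosNum e0)).
  exact: Ufree.
have xB k : N n (x k) <= 1 by rewrite x1.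
have [z [Jz Sz zx]] := approx_solution Jx xB (subspace0 Jsub) Sx.
have [k] := filter_ex (zx 1 ltr01).
rewrite (Sinj Jz Sz) (graph_dist Dlin Jdom JD)//; last exact: subspace0.
by rewrite subr0 x1 ltxx.
Unshelve. all: by end_near. Qed.

Lemma iter_shift_mem k x : J x -> J (iter k (S mu) x).
Proof. by move=> Jx; elim: k => //= k; exact: shift_mem. Qed.

Lemma iter_shift_linear k a x y : J x -> J y ->
  iter k (S mu) (a *: x + y) = a *: iter k (S mu) x + iter k (S mu) y.
Proof.
move=> Jx Jy; elim: k => //= k ->.
by rewrite shift_linear//; exact: iter_shift_mem.
Qed.

(** The lower bound keeps the arguments of the outermost [S mu] bounded, and [approx_solution] turns
    them into an exact preimage in [J], itself a limit of values of the remaining iterate. *)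
Lemma iter_shift_closed k y : J y ->
  (forall e, 0 < e -> exists x, J x /\ N n (iter k (S mu) x - y) < e) ->
  exists x, J x /\ iter k (S mu) x = y.
Proof.
elim: k y => [|k IH] y Jy hy; first by exists y.
have [c [c0 hc]] := shift_bounded_below.
have ex (i : nat) : exists x, J x /\ N n (iter k.+1 (S mu) x - y) < i.+1%:R^-1.
  by apply: hy; rewrite invr_gt0.
have [X hX] := choice ex.
pose w i := iter k (S mu) (X i).
have Jw i : J (w i) by apply: iter_shift_mem; exact: (hX i).1.
have Sw i : N n (S mu (w i) - y) < i.+1%:R^-1 by exact: (hX i).2.
have wB i : N n (w i) <= c * (1 + N n y).
  apply: le_trans (hc _ (Jw i)) _; apply: ler_wpM2l => //.
  rewrite -[S mu (w i)](subrK y).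
  apply: le_trans (graph_normD Dlin Jdom JD _ _ _) _ => //.
    by apply: subspaceB => //; exact: shift_mem.
  rewrite lerD2r; apply: ltW; apply: lt_le_trans (Sw i) _.
  by rewrite invf_le1// ler1n.
have Sw0 e : 0 < e -> \forall i \near U, N n (S mu (w i) - y) < e.
  move=> e0; have : \forall i \near \oo, N n (S mu (w i) - y) < e.
    near=> i; apply: lt_trans (Sw i) _; near: i.
    exact: (near_infty_natSinv_lt (PosNum e0)).
  exact: Ufree.
have [z [Jz Sz zw]] := approx_solution Jw wB Jy Sw0.
have [|x [Jx xz]] := IH z Jz.
  move=> e e0; have [i hi] := filter_ex (zw e e0).
  exists (X i); split; first exact: (hX i).1.
  by rewrite (graph_dist Dlin Jdom JD)//; exact: Jw.
by exists x; split => //; rewrite /= xz.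
Unshelve. all: by end_near. Qed.

Lemma iter_shift_inj k x : J x -> iter k (S mu) x = 0 -> x = 0.
Proof.
move=> Jx; elim: k => [//|k IH] /= h; apply: IH.
by apply: Sinj => //; exact: iter_shift_mem.
Qed.

(** If [y] were missed, the closed ranges [M k] of the powers of [S mu] would decrease strictly; the
    Riesz lemma then gives unit vectors [v k] of [M k] far from [M k.+1], whose images under
    [mu *: Q] are separated. *)
Lemma shift_surjective y : J y -> exists x, J x /\ S mu x = y.
Proof.
move=> Jy; apply: contrapT => hy.
pose M k := [set iter k (S mu) x | x in J].
have MJ k : M k `<=` J by move=> _ [x Jx <-]; exact: iter_shift_mem.
have Msub k : is_subspace (M k).
  split; first by exists 0; [exact: subspace0|elim: k => //= k ->; exact: shift0].
  move=> a _ _ [x1 Jx1 <-] [x2 Jx2 <-]; exists (a *: x1 + x2).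
    exact: Jsub.2.
  exact: iter_shift_linear.
have MS k x : M k x -> M k.+1 (S mu x).
  by move=> [x' Jx' <-]; exists x' => //; rewrite iterS.
have Mle k l x : (k <= l)%N -> M l x -> M k x.
  elim: l x => [|l IH] x; first by rewrite leqn0 => /eqP->.
  rewrite leq_eqVlt => /predU1P[->//|]; rewrite ltnS => kl [x' Jx' <-].
  apply: IH => //; exists (S mu x'); first exact: shift_mem.
  by rewrite iterSr.
have ey k : exists v, [/\ M k v, N n v = 1 & forall w, M k.+1 w -> 2^-1 <= N n (v - w)].
  pose v0 := iter k (S mu) y.
  have Jv0 : J v0 by exact: iter_shift_mem.
  (* At distance zero, closedness would put [v0] in [M k.+1], and cancelling [k] injective factors
     would put [y] in the range of [S mu]. *)
  have [d [d0 hd]] : exists d : R, 0 < d /\ forall v, M k.+1 v -> d <= N n (v0 - v).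
    apply: contrapT => hd.
    have [e e0|x [Jx xv0]] := @iter_shift_closed k.+1 v0 Jv0.
      apply: contrapT => he; apply: hd; exists e; split => // _ [x Jx <-].
      rewrite leNgt; apply/negP => hx; apply: he; exists x; split => //.
      by rewrite (graph_dist Dlin Jdom JD)//; exact: iter_shift_mem.
    apply: hy; exists x; split => //.
    apply/eqP; rewrite -subr_eq0; apply/eqP.
    have JSx := shift_mem mu Jx.
    apply: (@iter_shift_inj k); first exact: subspaceB.
    rewrite addrC -scaleN1r iter_shift_linear// -iterSr xv0 scaleN1r.
    exact: addNr.
  have [a [v [Mv v1 hv]]] := graph_riesz Dlin Jdom Jsub JD (Msub k.+1) (@MJ _) Jv0 d0 hd.
  exists (a *: (v0 - v)); split => //.
  apply: subspaceZ => //; apply: subspaceB => //; first by exists y.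
  exact: Mle Mv.
have [v hv] := choice ey.
have Jv k : J (v k) by apply: (MJ k); have [] := hv k.
apply: (@inverse_no_separated (fun k => mu *: v k) (rnorm mu) 2^-1) => [k|k||k l lk].
- exact: subspaceZ.
- by have [_ v1 _] := hv k; rewrite (graph_normZ Dlin Jdom)// v1 mulr1.
- by rewrite invr_gt0.
rewrite !inverse_scale//.
(* As [l < k], the sum in parentheses lies in [M l.+1]. *)
have -> : mu *: Q (v k) - mu *: Q (v l) = (S mu (v l) + (v k - S mu (v k))) - v l.
  by rewrite /shift subKr addrAC [_ - _ - v l]addrAC subrr add0r addrC.
have [Mk _ _] := hv k; have [Ml _ hl] := hv l.
have Mw : M l.+1 (S mu (v l) + (v k - S mu (v k))).
  apply: subspaceD => //; first exact: MS.
  apply: subspaceB => //; first exact: Mle Mk.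
  by apply: Mle (MS _ _ Mk); exact: leqW.
by rewrite (graph_dist Dlin Jdom JD)//; [exact: hl|exact: MJ Mw].
Qed.

End Injective.

(* [M k], the kernel of [S (mu 0) ... S (mu k.-1)], replaces the usual span of
   [e 0, ..., e k.-1]: it is closed because the product is bounded. *)
Lemma no_eigenvalue_sequence (mu : nat -> R[i]) (e : nat -> H) (B : R) :
  injective mu -> (forall k, rnorm (mu k) <= B) ->
  (forall k, [/\ J (e k), e k != 0 & e k = mu k *: Q (e k)]) -> False.
Proof.
move=> muI muB he.
have Je k : J (e k) by have [] := he k.
have mu0 k : mu k != 0.
  by have [_ ek ekE] := he k; apply: contra_neq ek => mk; rewrite ekE mk scale0r.
pose P := fix P k x := if k is k'.+1 then S (mu k') (P k' x) else x.
have JP k x : J x -> J (P k x) by move=> Jx; elim: k => //= k; exact: shift_mem.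
have PL k a x y : J x -> J y -> P k (a *: x + y) = a *: P k x + P k y.
  by move=> Jx Jy; elim: k => //= k ->; rewrite shift_linear//; exact: JP.
have J0 := subspace0 Jsub.
have PB k x y : J x -> J y -> P k (x - y) = P k x - P k y.
  by move=> Jx Jy; rewrite addrC -scaleN1r PL// scaleN1r addrC.
have SC a b x : J x -> S a (S b x) = S b (S a x).
  move=> Jx; have JQx := JQ Jx; have JQQ := JQ JQx.
  rewrite /shift !inverse_sub ?inverse_scale//; try exact: subspaceZ.
  rewrite !scalerBr !scalerA !opprB [b * a]mulrC [LHS]addrACA [RHS]addrACA.
  by congr (_ + _); rewrite addrC.
have PS k m x : J x -> P k (S m x) = S m (P k x).
  by move=> Jx; elim: k => //= k ->; rewrite SC//; exact: JP.
have Pbound k : exists K : R, 0 <= K /\ forall x, J x -> N n (P k x) <= K * N n x.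
  elim: k => [|k [K [K0 hK]]]; first by exists 1; split => // x _; rewrite mul1r.
  have [K' [K'0 hK']] := shift_graph_bounded (mu k).
  exists (K' * K); split => [|x Jx /=]; first exact: mulr_ge0.
  apply: le_trans (hK' _ (JP _ _ Jx)) _; rewrite -mulrA.
  by apply: ler_wpM2l => //; exact: hK.
(* [e l] is an eigenvector of each factor [S (mu i)] with eigenvalue [1 - mu i / mu l], which is
   nonzero for [i < k <= l] because [mu] is injective. *)
have Pe k l : (k <= l)%N -> exists c : R[i], c != 0 /\ P k (e l) = c *: e l.
  elim: k => [|k IH] kl; first by exists 1; rewrite oner_neq0 scale1r.
  have [c [c0 hc]] := IH (ltnW kl).
  have [_ _ el] := he l.
  exists (c * (1 - mu k / mu l)); split.
    rewrite mulf_neq0// subr_eq0; apply: contraTneq kl => h.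
    have /muI-> : mu k = mu l by rewrite -[RHS]mul1r h mulfVK.
    by rewrite ltnn.
  have Qe : Q (e l) = (mu l)^-1 *: e l by rewrite {2}el scalerA mulVf// scale1r.
  rewrite /= hc /shift inverse_scale// Qe !scalerA -scalerBl; congr (_ *: _).
  by rewrite [RHS]mulrBr mulr1 [in RHS]mulrCA !mulrA.
pose M k := [set x | J x /\ P k x = 0].
have MJ k : M k `<=` J by move=> x [].
have Msub k : is_subspace (M k).
  split; first by split => //=; elim: k => //= k ->; exact: shift0.
  move=> a x y [Jx Px] [Jy Py]; split; first exact: Jsub.2.
  by rewrite PL// Px Py scaler0 addr0.
have Mle k l x : (k <= l)%N -> M k x -> M l x.
  elim: l => [|l IH]; first by rewrite leqn0 => /eqP->.
  rewrite leq_eqVlt => /predU1P[->//|]; rewrite ltnS => kl /(IH kl)[Jx Px].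
  by split => //=; rewrite Px shift0.
have ey k : exists v, [/\ M k.+1 v, N n v = 1 & forall w, M k w -> 2^-1 <= N n (v - w)].
  have [K [K0 hK]] := Pbound k.
  have [c [c0 Pek]] := Pe k k (leqnn k).
  have [_ ek ekE] := he k.
  have Pek0 : 0 < N n (P k (e k)).
    apply: (@lt_le_trans _ _ (rnorm (P k (e k)))).
      by rewrite lt_neqAle rnorm_ge0 andbT eq_sym rnorm_eq0 Pek scaler_eq0 negb_or c0.
    exact: (@rnorm_le_graph_norm _ _ D n 0 _ isT).
  have K1 : 0 < K + 1 by rewrite ltr_wpDl.
  have d0 : 0 < N n (P k (e k)) / (K + 1) by rewrite divr_gt0.
  (* [P k] kills [M k] but not [e k], so its bound [K] keeps [e k] away from [M k]. *)
  have hd v : M k v -> N n (P k (e k)) / (K + 1) <= N n (e k - v).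
    move=> [Jv Pv]; rewrite ler_pdivrMr// mulrC.
    have -> : P k (e k) = P k (e k - v) by rewrite PB// Pv subr0.
    apply: le_trans (hK _ _) _; first exact: subspaceB.
    by rewrite ler_wpM2r ?graph_norm_ge0// lerDl.
  have [a [v [Mv v1 hv]]] := graph_riesz Dlin Jdom Jsub JD (Msub k) (@MJ _) (Je k) d0 hd.
  exists (a *: (e k - v)); split => //.
  apply: subspaceZ => //; apply: subspaceB => //; last exact: Mle Mv.
  split => //=; rewrite Pek /shift inverse_scale//.
  by rewrite scalerA mulrC -scalerA -ekE subrr.
have [v hv] := choice ey.
have Jv k : J (v k) by apply: (MJ k.+1); have [] := hv k.
apply: (@inverse_no_separated (fun k => mu k *: v k) B 2^-1) => [k|k||k l lk].
- exact: subspaceZ.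
- by have [_ v1 _] := hv k; rewrite (graph_normZ Dlin Jdom)// v1 mulr1.
- by rewrite invr_gt0.
rewrite !inverse_scale//.
(* The sum in parentheses lies in [M k]: [P k] sends [S (mu k) (v k)] to [P k.+1 (v k) = 0], and
   [v l] is in [M k] since [l < k]. *)
have -> : mu k *: Q (v k) - mu l *: Q (v l)
    = v k - (S (mu k) (v k) + (v l - S (mu l) (v l))).
  by rewrite /shift subKr opprD addrA subKr.
have [[_ Pk] _ hk] := hv k; have [Ml _ _] := hv l.
apply: hk; apply: subspaceD => //.
  by split; [exact: shift_mem|rewrite PS].
have Mkl : M k (v l) by exact: Mle Ml.
apply: subspaceB => //; split; first exact: shift_mem.
by rewrite PS// Mkl.2 shift0.
Qed.

(** * Eigenvalues and resolvent of D on J *)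

Lemma eigenvector_inverse lam x : J x -> D x = lam *: x <-> x = (lam - l0) *: Q x.
Proof.
move=> Jx; have JQx := JQ Jx.
have DZ a z : J z -> D (a *: z) = a *: D z by exact: (iter_scale Dlin Jdom Jsub JD 1).
have E : D ((lam - l0) *: Q x) = (lam - l0) *: x + l0 *: ((lam - l0) *: Q x).
  by rewrite DZ// DQE// scalerDr !scalerA [l0 * _]mulrC.
split=> [Dx|xE].
  apply: inj0 => //; first exact: subspaceZ.
  by rewrite E Dx addrK scalerBl.
by rewrite {1}xE E -xE scalerBl subrK.
Qed.

(** Solve [S (lam - l0) x = Q y]; applying [D - l0] gives the equation wanted. *)
Lemma resolvent_surjective lam : (forall x, J x -> D x = lam *: x -> x = 0) ->
  forall y, J y -> exists x, J x /\ D x - lam *: x = y.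
Proof.
move=> ker y Jy.
have Sinj x : J x -> S (lam - l0) x = 0 -> x = 0.
  by move=> Jx /subr0_eq /eigenvector_inverse-/(_ Jx); exact: ker.
have [x [Jx xE]] := shift_surjective Sinj (JQ Jy); exists x; split => //.
have JQx := JQ Jx; have JQy := JQ Jy.
have {1}-> : x = (lam - l0) *: Q x + Q y by rewrite -xE /shift addrC subrK.
rewrite Dlin; [|exact: Jdom|exact: Jdom].
rewrite !DQE// scalerDr scalerA [_ * l0]mulrC -scalerA addrACA -scalerDr.
have -> : (lam - l0) *: Q x + Q y = x by rewrite -xE /shift addrC subrK.
by rewrite scalerBl addrAC subrK addrAC subrr add0r.
Qed.

(** Near an accumulation point, eigenvalues can be picked each strictly closer than the one before,
    hence distinct and bounded, which [no_eigenvalue_sequence] excludes. *)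
Lemma eigenvalues_discrete :
  discrete_set [set lam | exists x, [/\ J x, x != 0 & D x = lam *: x]].
Proof.
set E := [set _ | _]; move=> lam _; apply: contrapT => hlam.
have ex (r : R) : exists m, 0 < r -> [/\ E m, 0 < rnorm (m - lam) & rnorm (m - lam) < r].
  have [r0|r0] := ltP 0 r; last by exists 0.
  apply: contrapT => hr; apply: hlam; exists r%:C%C; split; first by rewrite ltcR.
  move=> m Em; rewrite rnormE ltcR => mr; apply: contrapT => /eqP mlam.
  apply: hr; exists m => _; split => //.
  by rewrite lt_neqAle rnorm_ge0 eq_sym rnorm_eq0 subr_eq0 mlam.
have [g hg] := choice ex.
have [m [m0 mS Em]] : exists m : nat -> R[i], [/\ forall k, 0 < rnorm (m k - lam),
    forall k, rnorm (m k.+1 - lam) < rnorm (m k - lam) & forall k, E (m k)].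
  pose m := fix m k := if k is k'.+1 then g (rnorm (m k' - lam)) else g 1.
  have m0 k : 0 < rnorm (m k - lam).
    by elim: k => [|k IH] /=; [have [] := hg 1 ltr01|have [] := hg _ IH].
  exists m; split => // k; first by have [] := hg _ (m0 k).
  by case: k => [|k] /=; [have [] := hg 1 ltr01|have [] := hg _ (m0 k)].
have mlt k l : (k < l)%N -> rnorm (m l - lam) < rnorm (m k - lam).
  elim: l => // l IH; rewrite ltnS leq_eqVlt => /predU1P[->//|/IH]; exact: lt_trans.
have mI : injective m.
  by move=> k l kl; have [/mlt|/mlt|//] := ltngtP k l; rewrite kl ltxx.
have [e he] := choice Em.
apply: (@no_eigenvalue_sequence (fun k => m k - l0) e (rnorm (m 0%N - lam) + rnorm (lam - l0))).
- exact: inj_comp (addIr _) mI.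
- move=> k; rewrite -(subrKA lam); apply: le_trans (rnormD _ _) _; rewrite lerD2r.
  by case: k => // k; apply: ltW; exact: mlt.
- by move=> k; have [Jek ek0 ekE] := he k; split => //; exact/eigenvector_inverse.
Qed.

End Riesz.
End Inverse.

Lemma spectrum_alternative (l0 : R[i]) :
  (forall x y, J x -> J y -> D x - l0 *: x = D y - l0 *: y -> x = y) ->
  (forall y, J y -> exists x, J x /\ D x - l0 *: x = y) ->
  (forall lam, (forall x, J x -> D x = lam *: x -> x = 0) ->
     forall y, J y -> exists x, J x /\ D x - lam *: x = y) /\
  discrete_set [set lam | exists x, [/\ J x, x != 0 & D x = lam *: x]].
Proof.
move=> inj0 surj0.
(* Outside [J] the requirement is vacuous, with 0 as witness, so [Q] can be a total function. *)
have ex y : exists x, J y -> J x /\ D x - l0 *: x = y.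
  have [/surj0 [x hx]|nJ] := pselect (J y); first by exists x.
  by exists 0 => /nJ.
have [Q hQ] := choice ex.
have JQ y : J y -> J (Q y) by case/hQ.
have DQ y : J y -> D (Q y) - l0 *: Q y = y by case/hQ.
have [n Qb] := inverse_bounded inj0 JQ DQ.
split; [exact: (resolvent_surjective inj0 JQ DQ Qb)|exact: (eigenvalues_discrete inj0 JQ DQ Qb)].
Qed.

End Bounded.

(** * The metric of C^oo(D) and a free ultrafilter *)

Lemma dinf_le (R : realType) (H : completeNormedModType R[i]) (D : H -> H)
    (x y : H) (p : nat) (d : R) : 0 <= d ->
  (forall j, (j < p)%N -> rnorm (iter j D x - iter j D y) <= d) ->
  dinf D x y <= 2 * d + 2 * 2 ^- p.
Proof.
move=> d0 hd; rewrite /dinf; set u := fun j : nat => _.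
pose t j : R := rnorm (iter j D x - iter j D y).
have t0 j : 0 <= t j := rnorm_ge0 _.
have uE j : u j = 2 ^- j * (t j / (1 + t j)) by [].
have p2 j : 0 < 2 ^- j :> R by rewrite invr_gt0 exprn_gt0.
have t1 j : 0 < 1 + t j by have := t0 j; lra.
have u0 j : 0 <= u j.
  by rewrite uE mulr_ge0 ?(ltW (p2 j))// divr_ge0 ?t0 ?(ltW (t1 j)).
have u1 j : u j <= 2 ^- j.
  by rewrite uE -[X in _ <= X]mulr1 ler_pM2l// ler_pdivrMr// mul1r lerDr.
have ud j : (j < p)%N -> u j <= d * 2 ^- j.
  move=> jp; rewrite uE mulrC ler_pM2r//.
  rewrite ler_pdivrMr//; have := hd j jp; rewrite -/(t j) => h.
  by rewrite mulrDr mulr1; apply: le_trans h _; rewrite lerDl mulr_ge0.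
have half m : 2 * 2 ^- m.+1 = 2 ^- m :> R.
  by rewrite exprS invfM mulrA mulfV// mul1r.
have sS m : series u m.+1 = series u m + u m.
  by rewrite !seriesEnat /= big_nat_recr.
(* Since [t / (1 + t)] is at most [t] and at most 1, the first [p] terms add up to at most [2 * d]
   and the rest to at most [2 * 2 ^- p]; the subtracted terms carry the induction. *)
have b1 m : (m <= p)%N -> series u m <= 2 * d - 2 * d * 2 ^- m.
  elim: m => [|m IH] mp.
    by rewrite seriesEnat /= big_geq// expr0 invr1 mulr1 subrr.
  have := IH (ltnW mp); have := ud _ mp; rewrite sS -(half m).
  by clear; move: (2 ^- m.+1) => h; nra.
have b2 m : series u (p + m)%N <= 2 * d + 2 * 2 ^- p - 2 * 2 ^- (p + m).
  elim: m => [|m IH].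
    rewrite addn0 addrK; apply: le_trans (b1 _ (leqnn p)) _.
    by rewrite gerDl oppr_le0 !mulr_ge0// ltW.
  rewrite addnS sS; have := u1 (p + m)%N; have := IH.
  by rewrite -(half (p + m)%N); clear; lra.
have nd : nondecreasing_seq (series u).
  by apply/nondecreasing_seqP => m; rewrite sS lerDl.
have ub m : series u m <= 2 * d + 2 * 2 ^- p.
  have [mp|/ltnW/subnKC <-] := leqP m p.
    apply: le_trans (b1 _ mp) _.
    have := p2 m; have := p2 p; have := d0; clear; move: (2 ^- m) (2 ^- p) => a b; nra.
  by apply: le_trans (b2 _) _; rewrite gerDl oppr_le0 mulr_ge0// ltW.
apply: limr_le; last exact: nearW.
(* The series is nondecreasing and bounded, so [limn] is a true limit here. *)
by apply: nondecreasing_is_cvgn => //; exists (2 * d + 2 * 2 ^- p) => _ [m _ <-].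
Qed.

(** First [p] makes the tail of the metric small; then [k] is found along [U] for the finitely many
    remaining orders. *)
Lemma closed_in_Cinf_cvg (R : realType) (H : completeNormedModType R[i])
    (U : set_system nat) (PU : ProperFilter U) (dom : set H) (D : H -> H)
    (J : set H) (x : H) (v : nat -> nat -> H) :
  closed_in_Cinf dom D J -> Cinf dom D x -> (forall p k, J (v p k)) ->
  (forall p j, (j <= p)%N -> (fun k => iter j D (v p k)) @ U --> iter j D x) ->
  J x.
Proof.
move=> Jcl Cx Jv hv; apply: Jcl => // e e0.
have e8 : 0 < e / 8 by rewrite divr_gt0.
have [p hp] : exists p : nat, 2 ^- p < e / 8.
  have [p _ hp] := near_infty_natSinv_lt (PosNum e8).
  exists p; apply: le_lt_trans (hp p (leqnn p)).
  rewrite lef_pV2 ?posrE ?exprn_gt0//.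
  by rewrite -natrX ler_nat ltn_expl.
have h : \forall k \near U, forall j : 'I_p.+1, rnorm (iter j D x - iter j D (v p k)) < e / 8.
  by apply: filter_forall => j; apply: rcvg_near (hv _ _ _) e8; rewrite -ltnS.
have [k hk] := filter_ex h.
exists (v p k); split => //.
apply: le_lt_trans (dinf_le (p := p) (d := e / 8) _ _) _; first exact: ltW.
  move=> j jp; have jp' : (j < p.+1)%N by exact: ltnW.
  exact: ltW (hk (Ordinal jp')).
lra.
Qed.

(** Fixed once, it replaces all passages to subsequences; freeness transfers to it whatever holds
    for large [k]. *)
Lemma free_ultrafilter : exists U : set_system nat, UltraFilter U /\ \oo `<=` U.
Proof. exact: (@ultraFilterLemma nat \oo _). Qed.

(** * The resolvent of V and the vectors phi_lam *)

Section Resolvent.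
Context (R : realType) (H : completeNormedModType R[i]).
Context (dom : set H) (D V : H -> H) (phi0 : H).
Hypotheses (Dop : lin_op dom D) (VL : compact_op V)
  (Vspec : spectrum_op V = [set 0]) (DV : forall x, dom (V x) /\ D (V x) = x)
  (phi0n : phi0 != 0) (phi0d : dom phi0) (Dphi0 : D phi0 = 0)
  (kerD : forall x, dom x -> D x = 0 -> exists c : R[i], x = c *: phi0).

Local Notation f := (phi V phi0).

(** For nonzero [lam] this map is [- lam] times [V - lam^-1], and [lam^-1] lies outside the spectrum
    of [V]. *)
Lemma resolvent_bijective lam : bijective (fun x => x - lam *: V x).
Proof.
have [->|l0] := eqVneq lam 0.
  by exists id => x; rewrite scale0r subr0.
have : ~ spectrum_op V lam^-1 by rewrite Vspec /=; apply/eqP; rewrite invr_eq0.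
move=> /contrapT [g gK Kg]; exists (fun y => g (- lam^-1 *: y)) => x.
  rewrite scalerBr scalerA mulNr mulVf// scaleN1r opprK addrC scaleNr.
  exact: gK.
have := Kg (- lam^-1 *: x); set y := g _ => h.
have : - lam *: (V y - lam^-1 *: y) = x by rewrite h scalerA mulrNN mulfV// scale1r.
by move=> E; rewrite -[RHS]E scalerBr !scaleNr scalerA mulfV// scale1r opprK addrC.
Qed.

(** Bijectivity supplies a solution, so the default branch of [xget] is never taken. *)
Lemma phiE lam : f lam - lam *: V (f lam) = phi0.
Proof.
have [g _ gK] := resolvent_bijective lam.
rewrite /phi; case: xgetP => [x -> //|/(_ (g phi0)) []]; exact: gK.
Qed.

Lemma phi_neq0 lam : f lam != 0.
Proof.
apply: contra_neq phi0n => f0; rewrite -(phiE lam) f0.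
by rewrite (compact_op0 VL) scaler0 subr0.
Qed.

Lemma D_phi lam : D (f lam) = lam *: f lam.
Proof.
rewrite -[X in D X](subrK (lam *: V (f lam))) phiE addrC.
by rewrite Dop.2 ?Dphi0 ?addr0 ?(DV _).2//; exact: (DV _).1.
Qed.

(** By [DV], the vector [x - lam *: V x] is in the kernel of [D], so it is the image of some
    [c *: f lam] under I - lam V, which is injective. *)
Lemma eigenvectorE lam x : dom x -> D x = lam *: x -> exists c, x = c *: f lam.
Proof.
move=> dx Dx.
have [d1 d2] := DV x.
have [c hc] : exists c : R[i], x - lam *: V x = c *: phi0.
  rewrite addrC -scaleNr; apply: kerD; first exact: Dop.1.2.
  by rewrite Dop.2// d2 Dx scaleNr addNr.
exists c; have [g gK _] := resolvent_bijective lam.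
apply: (can_inj gK); rewrite hc /= -[in LHS](phiE lam).
by rewrite (compact_opZ VL) scalerBr !scalerA mulrC.
Qed.

End Resolvent.

(** * The dichotomy for the spectrum of D on J *)

Theorem theorem6p4 (R : realType) (H : completeNormedModType R[i])
  (ip : H -> H -> R[i]) (dom : set H) (D V : H -> H) (phi0 : H) (J : set H) :
  is_inner_product ip -> separable H ->
  admissible ip dom D V ->
  phi0 != 0 -> dom phi0 -> D phi0 = 0 ->
  J `<=` Cinf dom D -> is_subspace J -> closed_in_Cinf dom D J ->
  (forall x, J x -> J (D x)) ->
  (spec_on D J = setT \/
   (spec_on D J = [set lam | J (phi V phi0 lam)] /\
    discrete_set [set lam | J (phi V phi0 lam)])) /\
  (spec_on D J <> setT -> spec_on D J <> set0 ->
   forall lam, spec_on D J lam ->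
     phi V phi0 lam != 0 /\ J (phi V phi0 lam) /\
     forall x, J x -> (D x - lam *: x = 0 <-> exists c : R[i], x = c *: phi V phi0 lam)).
Proof.
move=> _ _ [[Dop [_ Dclosed]] [psi [psi0 psid Dpsi kerpsi]] _ [Vc Vspec] DV].
move=> phi0n phi0d Dphi0 JC Jsub Jcl JD.
(* Admissibility provides its own kernel vector [psi]; the given [phi0] is a nonzero multiple of it
   and spans the same line. *)
have kerD x : dom x -> D x = 0 -> exists c : R[i], x = c *: phi0.
  move=> dx /(kerpsi x dx)[c ->]; have [b phi0E] := kerpsi _ phi0d Dphi0.
  have b0 : b != 0 by apply: contra_neq phi0n => b0; rewrite phi0E b0 scale0r.
  by exists (c / b); rewrite phi0E scalerA mulfVK.
have [U [UU Ufree]] := free_ultrafilter.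
have PU : ProperFilter U by exact: ultra_proper.
have [domS Dlin] := Dop.
have Jdom : J `<=` dom by move=> x /JC /(_ 0%N).
have Drellich (y : nat -> H) : (forall k, dom (y k)) -> ev_bounded U y ->
    ev_bounded U (fun k => D (y k)) -> exists p : H, y @ U --> p.
  exact: graph_bounded_cvg Dop Vc DV phi0n kerD.
have Jclosed (x : H) (v : nat -> nat -> H) : Cinf dom D x -> (forall p k, J (v p k)) ->
    (forall p j, (j <= p)%N -> (fun k => iter j D (v p k)) @ U --> iter j D x) -> J x.
  exact: closed_in_Cinf_cvg Jcl.
have Dphi := D_phi Dop Vspec DV phi0d Dphi0.
have phi_n := phi_neq0 Vc Vspec phi0n.
have eigE lam x : J x -> D x = lam *: x -> exists c, x = c *: phi V phi0 lam.
  by move=> /Jdom dx; exact: (eigenvectorE Dop Vc Vspec DV kerD).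
have J0 := subspace0 Jsub.
have D0 : D 0 = 0 := iter_zero Dlin Jdom Jsub JD 1.
have spec_phi lam : J (phi V phi0 lam) -> spec_on D J lam.
  move=> Jphi [inj _]; have /eqP := phi_n lam; apply.
  by apply: (inj _ _ Jphi J0); rewrite Dphi D0 subrr scaler0 subr0.
have specE : spec_on D J <> setT -> spec_on D J = [set lam | J (phi V phi0 lam)] /\
    discrete_set [set lam | J (phi V phi0 lam)].
  move=> h.
  have [l0 /contrapT [inj0 surj0]] : exists l0, ~ spec_on D J l0.
    apply: contrapT => hl; apply: h; apply/seteqP; split => // l _.
    by apply: contrapT => hn; apply: hl; exists l.
  have [surj disc] := spectrum_alternative UU Ufree domS Dlin Dclosed Drellich
    JC Jsub JD Jclosed inj0 surj0.
  split.
    apply/seteqP; split => lam; last exact: spec_phi.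
    move=> hlam; apply: contrapT => nJ; apply: hlam.
    (* An eigenvector in [J] is a multiple of [phi V phi0 lam], and a nonzero multiple would put
       that vector into [J]. *)
    have ker x : J x -> D x = lam *: x -> x = 0.
      move=> Jx /(eigE _ _ Jx)[c xE]; have [c0|c0] := eqVneq c 0.
        by rewrite xE c0 scale0r.
      case: nJ; rewrite /= (_ : phi _ _ _ = c^-1 *: x); first exact: subspaceZ.
      by rewrite xE scalerA mulVf// scale1r.
    split; last exact: surj.
    move=> x y Jx Jy xy; apply: subr0_eq; apply: ker; first exact: subspaceB.
    have -> : D (x - y) = D x - D y := iter_sub Dlin Jdom JD 1 Jx Jy.
    have /(canRL (subrK _)) -> := xy.
    by rewrite scalerBr [LHS]addrC !addrA addNr add0r [LHS]addrC.
  move=> lam Jlam; have [|e [e0 he]] := disc lam.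
    by exists (phi V phi0 lam); split; [exact: Jlam|exact: phi_n|exact: Dphi].
  exists e; split => // mu Jmu; apply: he.
  by exists (phi V phi0 mu); split; [exact: Jmu|exact: phi_n|exact: Dphi].
split; first by have [|/specE] := pselect (spec_on D J = setT); [left|right].
move=> /specE[specphi _] _ lam; rewrite specphi => Jphi.
split; first exact: phi_n.
split => // x Jx; split=> [/subr0_eq|[c ->]]; first exact: eigE.
have -> : D (c *: phi V phi0 lam) = c *: D (phi V phi0 lam)
  := iter_scale Dlin Jdom Jsub JD 1 c Jphi.
by rewrite Dphi !scalerA mulrC subrr.
Qed.
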